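(* Consider the approximate accelerated stochastic mirror descent (ASMD) iterations $x^{(k)},y^{(k)}$ defined in the context, for minimizing a convex differentiable function $f$ with minimizer $x^*$. Suppose $f$ has $L_f$-Lipschitz gradient, the mirror potential $\psi$ is $\alpha$-strongly convex, the approximation error $U^{(k)}=U(y^{(k)})$ is bounded, and the stochastic oracle is otherwise unbiased with bounded second moments, i.e. $\mathbb{E}[\mathsf{G}(x^{(k)},\xi^{(k)})\mid x^{(k)}]=\nabla f(x^{(k)})$ and $\mathbb{E}[\|\mathsf{G}(x^{(k)},\xi^{(k)})\|_*^2\mid x^{(k)}]\le\sigma^2$. Assume that there is a constant $M_\psi>0$ with $M_\psi=\sup_{x,x'\in\mathcal{X}}B_\psi(x,x')$, and suppose further that there exists a constant $K$ such that for every $k\ge 0$, $$\langle\nabla f(x^{(k+1)}),U^{(k)}\rangle\le K.$$ Then $$\mathbb{E}[f(x^{(k)})-f(x^* )]\le K+\frac{\mathcal{E}^{(0)}}{A_k}+\frac{(k+1)^{3/2}}{A_k}\left[M_\psi+\frac{8L_f^2M_\psi+2\alpha\sigma^2+4\|\nabla f(x^* )\|_*^2}{\alpha^2}\right]=K+\mathcal{O}(k^{-2}+k^{-1/2}),$$ where $\mathcal{E}^{(k)}=\mathbb{E}\left[A_k(f(x^{(k)})-f(x^* ))+s_kB_\psi(x^*,\nabla\psi^*(y^{(k)}))\right]$.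
   Context: $\mathbb{R}^n$ carries a norm $\|\cdot\|$, with dual norm $\|p\|_*=\sup\{\langle p,x\rangle:\|x\|\le1\}$ on $(\mathbb{R}^n)^*$. $\mathcal{X}$ is a closed convex subset of $\mathbb{R}^n$. The mirror potential $\psi:\mathcal{X}\to\mathbb{R}$ is $\mathcal{C}^1$ and $\alpha$-strongly convex ($\alpha>0$); $\psi^*$ is its convex conjugate, and the inverse mirror map $\nabla\psi^*=(\nabla\psi)^{-1}$ maps $(\mathbb{R}^n)^*$ into $\mathcal{X}$. The Bregman divergence is $B_\psi(x,y)=\psi(x)-\psi(y)-\langle\nabla\psi(y),x-y\rangle$. The gradient of $f$ is $L_f$-Lipschitz from $\|\cdot\|$ to $\|\cdot\|_*$. Approximate ASMD: start from a deterministic $x^{(0)}\in\mathcal{X}$ and $y^{(0)}=\nabla\psi(x^{(0)})$. Put $A_0=1/2$, $A_{k+1}=(k+1)(k+2)/2$, $\tau_k=(A_{k+1}-A_k)/A_k$ and $s_k=(k+1)^{3/2}$ for $k\ge0$. For $k=0,1,2,\dots$: $$x^{(k+1)}=\frac{\tau_k}{\tau_k+1}\left[\nabla\psi^*(y^{(k)})+U(y^{(k)})\right]+\frac{1}{\tau_k+1}x^{(k)},$$ $$y^{(k+1)}=y^{(k)}-\frac{A_{k+1}-A_k}{s_k}\,\mathsf{G}(x^{(k+1)},\xi^{(k+1)}),$$ where $U$ is a (primal) approximation error modelling inexact evaluation of $\nabla\psi^*$, $\xi^{(1)},\xi^{(2)},\dots$ are i.i.d., and $\mathsf{G}$ is the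 stochastic gradient oracle. The iterates are assumed to remain in $\mathcal{X}$, where $f$ and $\mathsf{G}$ are defined. *)

(* Defs.v *)
From HB Require Import structures.
From mathcomp Require Import all_boot all_order all_algebra.
From mathcomp Require Import all_classical all_reals all_analysis.
Set Implicit Arguments.
Unset Strict Implicit.
Unset Printing Implicit Defensive.
Import Order.TTheory GRing.Theory Num.Theory.
Import numFieldNormedType.Exports.
Local Open Scope classical_set_scope.
Local Open Scope ring_scope.

(* Both R^n and its dual are represented by 'rV[R]_n; a functional p acts on a
   vector x by the coordinate pairing below. *)
Definition pairing (R : realType) (n : nat) (p x : 'rV[R]_n) : R :=
  \sum_(i < n) p 0 i * x 0 i.

(* N is an arbitrary norm on R^n, unrelated to the sup norm `|x| of the library;
   the library norm is only used for the (norm-independent) topology of R^n. *)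
Definition is_norm (R : realType) (n : nat) (N : 'rV[R]_n -> R) : Prop :=
  [/\ forall x, N x = 0 -> x = 0,
      forall a x, N (a *: x) = `|a| * N x &
      forall x y, N (x + y) <= N x + N y].

Definition dual_norm (R : realType) (n : nat) (N : 'rV[R]_n -> R)
    (p : 'rV[R]_n) : R :=
  sup [set pairing p x | x in [set x | N x <= 1]].

(* dg is a gradient of g : X -> R at every point of X, the increments being
   taken inside X (g is only meaningful on X). *)
Definition gradient_on (R : realType) (n : nat) (X : set 'rV[R]_n)
    (g : 'rV[R]_n -> R) (dg : 'rV[R]_n -> 'rV[R]_n) : Prop :=
  forall x, X x -> forall e : R, 0 < e ->
    \forall z \near within X (nbhs x),
      `|g z - g x - pairing (dg x) (z - x)| <= e * `|z - x|.

Definition strongly_convex_on (R : realType) (n : nat) (N : 'rV[R]_n -> R)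
    (X : set 'rV[R]_n) (alpha : R) (psi : 'rV[R]_n -> R) : Prop :=
  forall x y, X x -> X y -> forall t : R, 0 <= t <= 1 ->
    psi (t *: x + (1 - t) *: y) <=
      t * psi x + (1 - t) * psi y - alpha / 2 * t * (1 - t) * N (x - y) ^+ 2.

Definition lipschitz_gradient_on (R : realType) (n : nat) (N : 'rV[R]_n -> R)
    (X : set 'rV[R]_n) (L : R) (dg : 'rV[R]_n -> 'rV[R]_n) : Prop :=
  forall x y, X x -> X y -> dual_norm N (dg x - dg y) <= L * N (x - y).

Definition bregman (R : realType) (n : nat) (psi : 'rV[R]_n -> R)
    (dpsi : 'rV[R]_n -> 'rV[R]_n) (x y : 'rV[R]_n) : R :=
  psi x - psi y - pairing (dpsi y) (x - y).

(* sup of a set of reals is 0 when the set is empty or unbounded; here psi is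
   strongly convex on a closed X, so the supremum is finite for every p. *)
Definition convex_conjugate (R : realType) (n : nat) (X : set 'rV[R]_n)
    (psi : 'rV[R]_n -> R) (p : 'rV[R]_n) : R :=
  sup [set pairing p x - psi x | x in X].

Definition gradient (R : realType) (n : nat) (g : 'rV[R]_n -> R)
    (p : 'rV[R]_n) : 'rV[R]_n :=
  \row_(i < n) 'D_(delta_mx 0 i) (g : 'rV[R]_n -> R^o) p.

Definition inverse_mirror_map (R : realType) (n : nat) (X : set 'rV[R]_n)
    (psi : 'rV[R]_n -> R) : 'rV[R]_n -> 'rV[R]_n :=
  gradient (convex_conjugate X psi).

Definition borel_rV (R : realType) (n : nat) :=
  g_sigma_algebraType (@open 'rV[R]_n).

Definition sigma_of (R : realType) (n : nat) (T : Type) (V : T -> 'rV[R]_n) :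
    set_system T :=
  preimage_set_system setT V (@measurable _ (borel_rV R n)).

(* W is a version of E[Z | S], for a sub-sigma-algebra S *)
Definition is_cond_expectation (R : realType) (d : measure_display)
    (T : measurableType d) (P : probability T R) (S : set_system T)
    (Z W : T -> R) : Prop :=
  [/\ P.-integrable setT (EFin \o Z),
      P.-integrable setT (EFin \o W),
      forall B : set R, measurable B -> S (W @^-1` B) &
      forall C, S C ->
        (\int[P]_(w in C) (Z w)%:E = \int[P]_(w in C) (W w)%:E)%E].

Definition iid (R : realType) (d d' : measure_display) (T : measurableType d)
    (Xi : measurableType d') (P : probability T R) (xi : nat -> T -> Xi) : Prop :=
  [/\ forall k, measurable_fun setT (xi k),
      forall j k (B : set Xi), measurable B ->
        P (xi j @^-1` B) = P (xi k @^-1` B) &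
      forall (I : seq nat) (B : nat -> set Xi), uniq I ->
        (forall i, measurable (B i)) ->
        P (\bigcap_(i in [set` I]) (xi i @^-1` B i)) =
        (\prod_(i <- I) P (xi i @^-1` B i))%E].

Definition asmd_A (R : realType) (k : nat) : R :=
  if k is j.+1 then (j.+1%:R * j.+2%:R) / 2 else 1 / 2.

Definition asmd_tau (R : realType) (k : nat) : R :=
  (asmd_A R k.+1 - asmd_A R k) / asmd_A R k.

Definition asmd_s (R : realType) (k : nat) : R := k.+1%:R `^ (3 / 2).

Definition asmd_energy (R : realType) (d : measure_display)
    (T : measurableType d) (P : probability T R) (n : nat) (X : set 'rV[R]_n)
    (f psi : 'rV[R]_n -> R) (dpsi : 'rV[R]_n -> 'rV[R]_n) (xs : 'rV[R]_n)
    (x y : nat -> T -> 'rV[R]_n) (k : nat) : \bar R :=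
  ('E_P[fun w => (asmd_A R k * (f (x k w) - f xs) +
    asmd_s R k *
      bregman psi dpsi xs (inverse_mirror_map X psi (y k w)))%R])%E.

(* Main.v *)
Require Import Defs.
From HB Require Import structures.
From mathcomp Require Import all_boot all_order all_algebra.
From mathcomp Require Import all_classical all_reals all_analysis.
From mathcomp Require Import measurable_realfun.
From mathcomp Require Import ring lra zify.
Import Order.TTheory GRing.Theory Num.Theory.
Import numFieldNormedType.Exports.
Local Open Scope classical_set_scope.
Local Open Scope ring_scope.

(** Write z_k for the mirror point of the dual iterate y_k, so that dpsi z_k = y_k,
    and a_k = A_(k+1) - A_k. The proof follows the energy
      E_k = A_k (f (x_k) - f (xs)) + s_k B (xs, z_k),
    B being the Bregman divergence of psi. For a fixed outcome, the three-point
    identity for B, the bound of B (z_k, z_(k+1)) by the square of the dual norm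
    of y_k - y_(k+1) over 2 alpha, and the convexity of f give (asmd_step)
      E_(k+1) <= E_k + (s_(k+1) - s_k) Mpsi + a_k K
                 + a_k^2 / (2 alpha s_k) |G|_*^2 + a_k <G - df, xs - z_k>,
    where G and df are the oracle and the gradient of f at x_(k+1). The last term
    has mean zero and |G|_*^2 has mean at most sigma^2. Since a_k <= k + 1, the sum
    of a_j^2 / s_j over j < k is at most s_k, so, dropping the Bregman term,
      A_k E[f (x_k) - f (xs)] <= E_0 + s_k (Mpsi + sigma^2 / (2 alpha))
                                 + (A_k - A_0) K.
    The stated bound follows, as sigma^2 / (2 alpha) <= 2 sigma^2 / alpha, once
    K >= 0; this holds because A_k outgrows s_k while the left-hand side remains
    nonnegative.

    The delicate point is that <G - df, xs - z_k> has mean zero. The oracle is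
    assumed unbiased conditionally on x_(k+1) alone, and x_(k+1) does not determine
    z_k. But z_k and x_(k+1) are functions of the noise of the first k iterations,
    which is independent of the noise entering G; by Fubini, conditioning on that
    whole past gives the same conditional mean as conditioning on x_(k+1)
    (independent_mean0, past_independent, oracle_noise_mean0). For this the
    iterates must be measurable with respect to the past, hence the inverse mirror
    map must be measurable where it is used: by strong convexity it is Lipschitz on
    the image of X under dpsi, which contains the dual iterates
    (inverse_mirror_continuous). All integrability comes from the boundedness of
    X, a consequence of Mpsi being finite, and from that of the oracle. *)

(** * Borel measurability of row vectors *)

Lemma measurable_preimage_open (R : realType) (d : measure_display)
    (T : measurableType d) (g : T -> R) :
  (forall V : set R, open V -> measurable (g @^-1` V)) ->
  measurable_fun setT g.
Proof.
move=> gV; apply: (measurability _ (RGenOInfty.measurableE R)).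
by move=> _ [_ [a ->] <-]; rewrite setTI; apply: gV; exact: interval_open.
Qed.

Lemma closed_measurable_rV (R : realType) (n : nat) (A : set 'rV[R]_n) :
  closed A -> measurable (A : set (borel_rV R n)).
Proof.
move=> cA; rewrite -[A]setCK; apply: measurableC.
by apply: sub_sigma_algebra; exact: closed_openC.
Qed.

(** The set D need not be Borel: an open set of reals pulls back under g to the
    trace on D of an open set of the space, and v takes its values in D. *)
Lemma measurable_comp_continuous_within (R : realType) (n : nat)
    (d : measure_display) (T : measurableType d) (D : set 'rV[R]_n)
    (g : 'rV[R]_n -> R) (v : T -> 'rV[R]_n) :
  {within D, continuous g} -> (forall w, D (v w)) ->
  measurable_fun setT (v : T -> borel_rV R n) ->
  measurable_fun setT (g \o v).
Proof.
move=> /continuousP gc Dv mv; apply: measurable_preimage_open => V oV.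
have [W oW WV] := (open_subspaceP D (g @^-1` V)).1 (gc _ oV).
have -> : (g \o v) @^-1` V = v @^-1` W.
  apply/seteqP; split => w /= h.
    suff : (W `&` D) (v w) by case.
    by rewrite WV; split.
  suff : ((g @^-1` V) `&` D) (v w) by case.
  by rewrite -WV; split.
rewrite -[X in measurable X]setTI; apply: mv => //.
exact: sub_sigma_algebra.
Qed.

Lemma ball_rVE (R : realType) (n : nat) (x y : 'rV[R]_n) (e : R) : 0 < e ->
  ball x e y <-> forall i, `|x 0 i - y 0 i| < e.
Proof.
move=> e0; split=> [[_ h] i|h]; first exact: h.
by split=> // i j; rewrite (ord1 i); apply: h.
Qed.

Lemma measurable_coord (R : realType) (n : nat) (i : 'I_n) :
  measurable_fun setT (fun v : borel_rV R n => (v : 'rV[R]_n) 0 i).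
Proof.
apply: (@measurable_comp_continuous_within R n _ (borel_rV R n) setT
  (fun v : 'rV[R]_n => v 0 i) id).
- by apply: continuous_subspaceT => v; exact: coord_continuous.
- by [].
- exact: measurable_id.
Qed.

(** The rational cubes form a countable base of the topology. *)
Lemma open_rV_bigcup_rat (R : realType) (n : nat) (V : set 'rV[R]_n) :
  open V ->
  V = \bigcup_(q in [set q : 'rV[rat]_n * nat |
        ball (map_mx ratr q.1 : 'rV[R]_n) q.2.+1%:R^-1 `<=` V])
      ball (map_mx ratr q.1 : 'rV[R]_n) q.2.+1%:R^-1.
Proof.
move=> oV; apply/seteqP; split=> [x Vx|x [q qV qx]]; last exact: qV.
have /nbhs_ballP[e /= e0 xe] : nbhs x V by exact: open_nbhs_nbhs.
have [k ke] : exists k : nat, k.+1%:R^-1 < e / 2.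
  have [k _ hk] := near_infty_natSinv_lt (PosNum (divr_gt0 e0 (@ltr0Sn R 1))).
  by exists k; exact: (hk k (leqnn k)).
have k0 : 0 < (k.+1%:R^-1 : R) by rewrite invr_gt0.
have [r rE] : exists r : R, r = k.+1%:R^-1 by eexists.
rewrite -rE in ke k0; rename k0 into r0.
have /choice[q hq] : forall i : 'I_n, exists q : rat,
    `|x 0 i - ratr q| < r.
  move=> i.
  have : x 0 i - r < x 0 i + r by lra.
  move=> /rat_in_itvoo[q]; rewrite in_itv /= => /andP[h1 h2].
  by exists q; rewrite ltr_distlC; apply/andP; split; lra.
exists (\row_i q i, k); last first.
  by apply/ball_rVE => [|i]; rewrite /= -rE // !mxE distrC.
move=> z /=; rewrite -rE => /ball_rVE hz; apply: xe; apply/ball_rVE => // i.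
have := hz r0 i; rewrite !mxE => h1; have h2 := hq i.
by apply: le_lt_trans (ler_distD (ratr (q i)) _ _) _; lra.
Qed.

(** Measurability for the Borel sets of row vectors is coordinatewise. *)
Lemma measurable_rV (R : realType) (n : nat) (d : measure_display)
    (T : measurableType d) (v : T -> 'rV[R]_n) :
  (forall i, measurable_fun setT (fun w => v w 0 i)) ->
  measurable_fun setT (v : T -> borel_rV R n).
Proof.
move=> mv; apply: (measurability _
  (erefl _ : @measurable _ (borel_rV R n) = <<s @open 'rV[R]_n >>)).
move=> _ [V oV <-]; rewrite setTI (open_rV_bigcup_rat _ _ V oV).
rewrite preimage_bigcup bigcup_mkcond.
apply: countable_bigcupT_measurable; first exact: countableP.
move=> q; case: ifP => // _.
have -> : v @^-1` ball (map_mx ratr q.1 : 'rV[R]_n) q.2.+1%:R^-1 =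
    \bigcap_(i in [set: 'I_n])
     (fun w => v w 0 i) @^-1` ball (ratr (q.1 0 i) : R) q.2.+1%:R^-1.
  apply/seteqP; split=> w /=.
    move=> /ball_rVE h i _ /=; rewrite /ball /=.
    by have := h _ i; rewrite mxE; apply; rewrite invr_gt0.
  by move=> h; apply/ball_rVE => [|i]; [rewrite invr_gt0|rewrite mxE; exact: h].
apply: fin_bigcap_measurable => [|i _]; first exact: finite_finset.
by rewrite -[X in measurable X]setTI; apply: mv => //; exact: measurable_ball.
Qed.

(** * Integrals over independent maps *)

Section independence.
Context {R : realType} {d d1 d2 : measure_display} {T : measurableType d}
  {T1 : measurableType d1} {T2 : measurableType d2} (P : probability T R).
Local Open Scope ereal_scope.

(** Independence of two maps into measurable spaces, as the product rule on
    pairs of measurable sets. *)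
Definition independent_maps (V : T -> T1) (xi : T -> T2) : Prop :=
  forall A B, measurable A -> measurable B ->
    P (V @^-1` A `&` xi @^-1` B) = P (V @^-1` A) * P (xi @^-1` B).

Variables (V : {mfun T >-> T1}) (xi : {mfun T >-> T2}).
Hypothesis Vxi : independent_maps V xi.

Let W : T -> T1 * T2 := fun w => (V w, xi w).

Let mW : measurable_fun setT W.
Proof. by apply: measurable_fun_pair. Qed.

Let W' : {mfun T >-> (T1 * T2)%type} := mfun_Sub (mem_set mW).

(* the joint law of independent maps is the product of their laws *)
Let law_pair (A : set (T1 * T2)) : measurable A ->
  (distribution P V \x distribution P xi) A = distribution P W' A.
Proof.
move=> mA.
apply: (product_measure_unique (m1 := distribution P V)
  (m2 := distribution P xi) (m' := distribution P W')) mA => B C mB mC.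
exact: Vxi.
Qed.

Variable Psi : T1 * T2 -> R.
Hypothesis mPsi : measurable_fun setT Psi.
Hypothesis iPsi : P.-integrable setT (fun w => (Psi (V w, xi w))%:E).

Lemma independent_integrable_prod :
  (distribution P V \x distribution P xi).-integrable setT (EFin \o Psi).
Proof.
have mE : measurable_fun setT (EFin \o Psi) by exact/measurable_EFinP.
apply/integrableP; split=> //.
rewrite (eq_measure_integral (distribution P W')) => [|A mA _];
  last exact: law_pair.
rewrite ge0_integral_pushforward //; last exact: measurableT_comp.
rewrite preimage_setT; by case/integrableP: iPsi.
Qed.

(** Fubini: one may integrate over the second of two independent maps while the
    first one is held fixed. *)
Lemma independent_integral :
  \int[P]_w (Psi (V w, xi w))%:E =
  \int[distribution P V]_t \int[distribution P xi]_e (Psi (t, e))%:E.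
Proof.
have mE : measurable_fun setT (EFin \o Psi) by exact/measurable_EFinP.
have := integral12_prod_meas1 (f := EFin \o Psi) independent_integrable_prod.
rewrite /fubini_F /= => ->.
rewrite (eq_measure_integral (distribution P W')) => [|A mA _];
  last exact: law_pair.
by rewrite integral_pushforward // preimage_setT.
Qed.

End independence.

Section independent_mean0.
Context {R : realType} {d d1 d2 d3 : measure_display} {T : measurableType d}
  {T1 : measurableType d1} {T2 : measurableType d2} {S : measurableType d3}
  (P : probability T R).
Local Open Scope ereal_scope.

Lemma integrable_mul_bounded (f h : T -> R) (C : R) :
  P.-integrable setT (EFin \o f) -> measurable_fun setT h ->
  (forall w, `|h w| <= C)%R ->
  P.-integrable setT (fun w => (f w * h w)%:E).
Proof.
move=> fi mh hC.
have mf : measurable_fun setT f.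
  by apply/measurable_EFinP; case/integrableP: fi.
apply: (@le_integrable _ _ _ P _ measurableT _ (fun w => C%:E * (EFin \o f) w)).
- by apply/measurable_EFinP; exact: measurable_funM.
- move=> w _ /=; rewrite lee_fin !normrM mulrC ler_wpM2r //.
  exact: le_trans (hC w) (ler_norm _).
- exact: integrableZl.
Qed.

Variables (V : {mfun T >-> T1}) (xi : {mfun T >-> T2}).
Hypothesis Vxi : independent_maps P V xi.

(** If Gam (X, xi), with X = phi (V), has mean zero on every event that depends
    on X only, then it is orthogonal to every bounded function of V, although V
    may carry more information than X. Indeed, V being independent of xi, the
    conditional mean of Gam (X, xi) given V is D (X), where D x is the mean of
    Gam (x, xi) at fixed x; the hypothesis says that the integral of D vanishes
    on every set for the law of X, so that D (X) = 0 almost surely. *)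
Lemma independent_mean0 (phi : T1 -> S) (Gam : S * T2 -> R) (h : T1 -> R)
    (C : R) :
  measurable_fun setT phi -> measurable_fun setT Gam ->
  measurable_fun setT h -> (forall t, `|h t| <= C)%R ->
  P.-integrable setT (fun w => (Gam (phi (V w), xi w))%:E) ->
  (forall B, measurable B ->
    \int[P]_(w in (phi \o V) @^-1` B) (Gam (phi (V w), xi w))%:E = 0) ->
  \int[P]_w (Gam (phi (V w), xi w) * h (V w))%:E = 0.
Proof.
move=> mphi mGam mh hC iGam Gam0.
have mX : measurable_fun setT (phi \o V) by exact: measurableT_comp.
pose X : {mfun T >-> S} := mfun_Sub (mem_set mX).
have Xxi : independent_maps P X xi.
  move=> A B mA mB; rewrite /= comp_preimage; apply: Vxi => //.
  by rewrite -[Y in measurable Y]setTI; exact: mphi.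
pose D x := \int[distribution P xi]_e (Gam (x, e))%:E.
have iD : (distribution P X).-integrable setT D.
  exact: (integrable_fubini_F
    (independent_integrable_prod P X xi Xxi Gam mGam iGam)).
have D0 : ae_eq (distribution P X) setT D (cst 0).
  apply: integral_ae_eq => // B _ mB.
  rewrite integral0 integral_mkcond.
  have mI : measurable_fun setT (\1_(B `*` [set: T2]) : S * T2 -> R).
    by apply: measurable_indic; exact: measurableX.
  have IE x e : (\1_(B `*` [set: T2]) (x, e) : R) = \1_B x.
    rewrite !indicE; suff -> : ((x, e) \in B `*` [set: T2]) = (x \in B) by [].
    apply/idP/idP => /set_mem xB; apply/mem_set; first by case: xB.
    by split.
  transitivity (\int[P]_w (Gam (phi (V w), xi w) *
      \1_(B `*` [set: T2]) (phi (V w), xi w))%:E).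
    rewrite (independent_integral P X xi Xxi
      (fun p => Gam p * \1_(B `*` [set: T2]) p)%R).
    - apply: eq_integral => x _; rewrite patchE.
      under [RHS]eq_integral do rewrite IE indicE.
      case: ifPn => xB /=.
        by apply: eq_integral => e _; rewrite mulr1.
      by under eq_integral do rewrite mulr0; rewrite integral0.
    - exact: measurable_funM.
    - apply: (integrable_mul_bounded _ _ 1) => //.
        by apply: measurableT_comp => //; exact: measurable_fun_pair.
      by move=> w; rewrite indicE normr_nat lern1 leq_b1.
  rewrite -(Gam0 _ mB) [RHS]integral_mkcond.
  apply: eq_integral => w _; rewrite patchE IE indicE.
  have -> : (w \in (phi \o V) @^-1` B) = (phi (V w) \in B).
    by apply/idP/idP; rewrite !inE.
  by case: ifPn => _; rewrite ?mulr1 ?mulr0.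
have mPsi : measurable_fun setT
    (fun p : T1 * T2 => Gam (phi p.1, p.2) * h p.1)%R.
  apply: measurable_funM; last exact: measurableT_comp.
  apply: (measurableT_comp mGam); apply: measurable_fun_pair => //.
  exact: measurableT_comp.
have mGp : measurable_fun setT (fun p : T1 * T2 => Gam (phi p.1, p.2)).
  apply: (measurableT_comp mGam); apply: measurable_fun_pair => //.
  exact: measurableT_comp.
have iPsi : P.-integrable setT (fun w => (Gam (phi (V w), xi w) * h (V w))%:E).
  by apply: (integrable_mul_bounded _ _ C) => //; exact: measurableT_comp.
have prodi := independent_integrable_prod P V xi Vxi _ mPsi iPsi.
rewrite (independent_integral P V xi Vxi _ mPsi iPsi) /=.
rewrite -[RHS](@integral0 _ _ _ (distribution P V) setT).
apply: ae_eq_integral => //; first exact: (measurable_fubini_F prodi).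
have aei := ae_integrable1 (independent_integrable_prod P V xi Vxi _ mGp iGam).
have aeD : {ae distribution P V, forall t, D (phi t) = 0}.
  case: D0 => N [mN N0 DN]; exists (phi @^-1` N); split=> //.
  - by rewrite -[Y in measurable Y]setTI; exact: mphi.
  - move=> t /= Dt; by apply: DN => /= Dt0; exact: Dt (Dt0 I).
apply: filterS2 aei aeD => t /= it Dt _.
under eq_integral do rewrite EFinM.
by rewrite integralZr // -/(D (phi t)) Dt mul0e.
Qed.

End independent_mean0.

(** * The history of a sequence of random variables *)

(** The events prescribing eta 0, ..., eta (k - 1) separately; they form a
    pi-system generating the past before time k. *)
Definition past_cylinders {d' : measure_display} {T : Type}
    {Xi : measurableType d'} (eta : nat -> T -> Xi) (k : nat) : set_system T :=
  [set A | exists2 B : nat -> set Xi, (forall i, measurable (B i)) &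
     A = \bigcap_(i in [set` iota 0 k]) eta i @^-1` B i].

(** The sample space T with the sigma-algebra generated by eta 0, ...,
    eta (k - 1); a map measurable from past eta k is adapted to this history. *)
Definition past {d d' : measure_display} {T : measurableType d}
    {Xi : measurableType d'} (eta : nat -> T -> Xi) (k : nat) :=
  g_sigma_algebraType (past_cylinders eta k).

Lemma set_iotaE (k : nat) : [set` iota 0 k] = [set i | (i < k)%N].
Proof. by apply/seteqP; split=> i; rewrite /mkset mem_iota add0n. Qed.

Section past.
Context {R : realType} {d d' : measure_display} {T : measurableType d}
  {Xi : measurableType d'} (P : probability T R) (eta : nat -> T -> Xi).
Hypothesis eta_meas : forall k, measurable_fun setT (eta k).

Lemma setI_closed_past_cylinders k : setI_closed (past_cylinders eta k).
Proof.
move=> _ _ [A mA ->] [B mB ->]; exists (fun i => A i `&` B i) => [i|].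
  exact: measurableI.
apply/seteqP; split=> w.
  by move=> [hA hB] i ik; split; [exact: hA|exact: hB].
by move=> h; split=> i ik; have [] := h i ik.
Qed.

Lemma past_cylinders_measurable k : past_cylinders eta k `<=` measurable.
Proof.
move=> _ [B mB ->]; apply: fin_bigcap_measurable; first exact: finite_seq.
by move=> i _; rewrite -[X in measurable X]setTI; exact: eta_meas.
Qed.

Lemma measurable_to_past k : measurable_fun setT (id : T -> past eta k).
Proof.
apply: (measurability _
  (erefl _ : @measurable _ (past eta k) = <<s past_cylinders eta k >>)).
move=> _ [A cA <-]; rewrite setTI preimage_id.
exact: (past_cylinders_measurable k).
Qed.

Lemma measurable_past_succ k :
  measurable_fun setT (id : past eta k.+1 -> past eta k).
Proof.
apply: (measurability _
  (erefl _ : @measurable _ (past eta k) = <<s past_cylinders eta k >>)).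
move=> _ [_ [B mB ->] <-]; rewrite setTI preimage_id; apply: sub_sigma_algebra.
exists (fun i => if (i < k)%N then B i else setT) => [i|].
  by case: ifP => // _; exact: measurableT.
rewrite !set_iotaE; apply/seteqP; split=> w h i /= ik.
  by case: ifP => // ik'; exact: h.
by have := h i (leq_trans ik (leqnSn _)); rewrite /= ik.
Qed.

Lemma measurable_past_last k :
  measurable_fun setT (eta k : past eta k.+1 -> Xi).
Proof.
move=> _ A mA; rewrite setTI; apply: sub_sigma_algebra.
exists (fun i => if i == k then A else setT) => [i|].
  by case: ifP => // _; exact: measurableT.
rewrite set_iotaE; apply/seteqP; split=> w h; last first.
  by have := h k (ltnSn k); rewrite /= eqxx.
by move=> i _ /=; case: ifP => // /eqP ->.
Qed.

(** The past before time k is independent of eta k: both sides are finite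
    measures in the first argument, and they agree on the cylinders. *)
Lemma past_independent k : iid P eta ->
  independent_maps P (id : T -> past eta k) (eta k).
Proof.
move=> [_ _ ieta] A B mA mB.
have mD : measurable (eta k @^-1` B).
  by rewrite -[X in measurable X]setTI; exact: eta_meas.
have r0 : 0 <= fine (P (eta k @^-1` B)) by exact: fine_ge0.
have -> : (P (id @^-1` A) * P (eta k @^-1` B) =
    (fine (P (eta k @^-1` B)))%:E * P A)%E.
  by rewrite muleC fineK // fin_num_measure.
apply: (g_sigma_algebra_measure_unique (past_cylinders eta k) _
  (fun=> setT) _ _ (mrestr P mD) (mscale (NngNum r0) P)) => //.
- exact: past_cylinders_measurable.
- by move=> _; exists (fun=> setT) => //; apply/seteqP; split.
- by apply/seteqP; split=> // w _; exists 0%N.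
- exact: setI_closed_past_cylinders.
- move=> _ [C mC ->]; 
  change (P (\bigcap_(i in [set` iota 0 k]) eta i @^-1` C i `&`
      eta k @^-1` B) = (fine (P (eta k @^-1` B)))%:E *
    P (\bigcap_(i in [set` iota 0 k]) eta i @^-1` C i))%E.
  rewrite fineK ?fin_num_measure // muleC.
  have cyl j (F : nat -> set Xi) : (forall i, measurable (F i)) ->
      P (\bigcap_(i in [set` iota 0 j]) eta i @^-1` F i) =
      (\prod_(i <- iota 0 j) P (eta i @^-1` F i))%E.
    by move=> mF; apply: ieta => //; exact: iota_uniq.
  pose F i := if i == k then B else C i.
  have -> : \bigcap_(i in [set` iota 0 k]) eta i @^-1` C i `&` eta k @^-1` B =
      \bigcap_(i in [set` iota 0 k.+1]) eta i @^-1` F i.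
    rewrite !set_iotaE; apply/seteqP; split=> w.
      move=> [hC hB] i /=; rewrite ltnS leq_eqVlt /F.
      by case: eqP => [-> //|_ /= ik]; exact: hC.
    move=> h; split=> [i /= ik|].
      by have := h i (leq_trans ik (leqnSn _)); rewrite /= /F (ltn_eqF ik).
    by have := h k (ltnSn k); rewrite /= /F eqxx.
  rewrite !cyl //; last by move=> i; rewrite /F; case: ifP.
  rewrite -addn1 iotaD big_cat /= add0n big_seq1 /F eqxx; congr (_ * _)%E.
  rewrite big_seq [RHS]big_seq; apply: eq_bigr => i.
  by rewrite mem_iota /= add0n => /ltn_eqF ->.
- move=> _; change (P (setT `&` eta k @^-1` B) < +oo)%E; rewrite setTI.
  by rewrite (le_lt_trans (probability_le1 P mD)) // ltry.
Qed.

End past.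

(** * Pairings and norms *)

Lemma coord_le_norm {R : realType} {n : nat} (x : 'rV[R]_n) i : `|x 0 i| <= `|x|.
Proof.
rewrite [leRHS]/Num.norm /= mx_normrE.
by apply: (le_bigmax _ (fun ij : 'I_1 * 'I_n => `|x ij.1 ij.2|) (0, i)).
Qed.

Section pairing.
Context {R : realType} {n : nat}.
Implicit Types p q x y : 'rV[R]_n.

Lemma pairingDl p q x : pairing (p + q) x = pairing p x + pairing q x.
Proof. by rewrite -big_split; apply: eq_bigr => i _; rewrite mxE mulrDl. Qed.

Lemma pairingDr p x y : pairing p (x + y) = pairing p x + pairing p y.
Proof. by rewrite -big_split; apply: eq_bigr => i _; rewrite mxE mulrDr. Qed.

Lemma pairingZl a p x : pairing (a *: p) x = a * pairing p x.
Proof. by rewrite /pairing mulr_sumr; apply: eq_bigr => i _; rewrite mxE mulrA. Qed.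

Lemma pairingZr a p x : pairing p (a *: x) = a * pairing p x.
Proof. by rewrite /pairing mulr_sumr; apply: eq_bigr => i _; rewrite mxE mulrCA. Qed.

Lemma pairingNl p x : pairing (- p) x = - pairing p x.
Proof. by rewrite -scaleN1r pairingZl mulN1r. Qed.

Lemma pairingNr p x : pairing p (- x) = - pairing p x.
Proof. by rewrite -scaleN1r pairingZr mulN1r. Qed.

Lemma pairingBl p q x : pairing (p - q) x = pairing p x - pairing q x.
Proof. by rewrite pairingDl pairingNl. Qed.

Lemma pairingBr p x y : pairing p (x - y) = pairing p x - pairing p y.
Proof. by rewrite pairingDr pairingNr. Qed.

Lemma pairing_delta p i : pairing p (delta_mx 0 i) = p 0 i.
Proof.
rewrite /pairing (bigD1 i) //= mxE !eqxx mulr1 big1 ?addr0 // => j ji.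
by rewrite mxE (negbTE ji) andbF mulr0.
Qed.

Lemma normr_pairing_le p x : `|pairing p x| <= n%:R * `|p| * `|x|.
Proof.
apply: le_trans (ler_norm_sum _ _ _) _.
apply: (@le_trans _ _ (\sum_(i < n) `|p| * `|x|)).
  apply: ler_sum => i _; rewrite normrM.
  by apply: ler_pM => //; exact: coord_le_norm.
by rewrite sumr_const card_ord -mulrA mulr_natl.
Qed.

End pairing.

Lemma near_dist_le {R : realType} {n : nat} (x : 'rV[R]_n) (e : R) : 0 < e ->
  \forall z \near x, `|x - z| <= e.
Proof. by move=> e0; apply/nbhs_normP; exists e => //= z /ltW. Qed.

Lemma locally_lipschitz_continuous_within {R : realType} {n : nat}
    (D : set 'rV[R]_n) (g : 'rV[R]_n -> R) :
  (forall x, D x -> exists C : R,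
    \forall z \near within D (nbhs x), `|g z - g x| <= C * `|z - x|) ->
  {within D, continuous g}.
Proof.
move=> gD; apply/subspace_continuousP => x Dx.
have [C gC] := gD x Dx; apply/cvgrPdist_le => e e0.
have C0 : 0 < `|C| + 1 by rewrite ltr_wpDl.
have xe : \forall z \near x, `|x - z| <= e / (`|C| + 1).
  by apply: near_dist_le; exact: divr_gt0.
move: gC xe; rewrite !near_withinE; apply: filterS2 => z gz xz Dz.
rewrite distrC; apply: le_trans (gz Dz) _; rewrite distrC.
apply: (@le_trans _ _ ((`|C| + 1) * `|x - z|)).
  by rewrite ler_wpM2r // (le_trans (ler_norm C)) // lerDl.
by rewrite mulrC -ler_pdivlMr.
Qed.

Section norm.
Context {R : realType} {n : nat} (N : 'rV[R]_n -> R) (hN : is_norm N).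
Implicit Types p x y : 'rV[R]_n.

Let NZ a x : N (a *: x) = `|a| * N x. Proof. by case: hN. Qed.

Lemma is_norm0 : N 0 = 0.
Proof. by rewrite -(scale0r 0) NZ normr0 mul0r. Qed.

Lemma is_normN x : N (- x) = N x.
Proof. by rewrite -scaleN1r NZ normrN1 mul1r. Qed.

Lemma is_norm_ge0 x : 0 <= N x.
Proof.
have : N (x - x) <= N x + N (- x) by case: hN.
by rewrite subrr is_norm0 is_normN -mulr2n pmulrn_lge0.
Qed.

Lemma is_norm_le : exists2 C, 0 <= C & forall x, N x <= C * `|x|.
Proof.
exists (\sum_(i < n) N (delta_mx 0 i)).
  by apply: sumr_ge0 => i _; exact: is_norm_ge0.
move=> x; rewrite [in leLHS](row_sum_delta x) mulr_suml.
apply: (@le_trans _ _ (\sum_(i < n) N (x 0 i *: delta_mx 0 i))).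
  have N0 := is_norm0.
  elim/big_ind2 : _ => //; first by rewrite N0.
  move=> u a v b ua vb; apply: le_trans (lerD ua vb); by case: hN.
apply: ler_sum => i _; rewrite NZ mulrC.
by apply: ler_wpM2l; [exact: is_norm_ge0|exact: coord_le_norm].
Qed.

Lemma is_norm_continuous_within D : {within D, continuous N}.
Proof.
have [C _ NC] := is_norm_le.
have NB u v : N u - N v <= N (u - v).
  by rewrite lerBlDr -{1}(subrK v u); case: hN.
apply: locally_lipschitz_continuous_within => x _; exists C; apply: nearW => z.
apply: le_trans (NC _); rewrite ler_norml NB andbT lerNl opprB.
by apply: le_trans (NB x z) _; rewrite -is_normN opprB.
Qed.

(** Lower half of the equivalence of norms: N attains a positive minimum on the
    compact unit sphere of the sup norm. *)
Lemma is_norm_ge : exists2 c, 0 < c & forall x, c * `|x| <= N x.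
Proof.
pose S := [set x : 'rV[R]_n | `|x| = 1].
have normS x : x != 0 -> S (`|x|^-1 *: x).
  by move=> x0; rewrite /S /= normrZ normfV normr_id mulVf // normr_eq0.
have [S0|/set0P S0] := eqVneq S set0.
  exists 1 => // x; have [->|/normS] := eqVneq x 0; last by rewrite S0.
  by rewrite normr0 mulr0 is_norm_ge0.
have cS : compact S.
  apply: bounded_closed_compact.
    by exists 1; split => // M M1 x /= ->; exact: ltW.
  have -> : S = Num.norm @^-1` [set 1 : R] by [].
  by apply: closed_comp => [x _|]; [exact: norm_continuous|exact: closed_eq].
have [u uS Nu] : exists2 u, u \in S & forall x, x \in S -> N u <= N x.
  by apply: compact_EVT_min => //; exact: is_norm_continuous_within.
have Nu0 : 0 < N u.
  rewrite lt_neqAle is_norm_ge0 andbT eq_sym; apply/eqP => Nu0.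
  have u0 : u = 0 by case: hN => + _ _; exact.
  by move: uS; rewrite inE /S /= u0 normr0 => /esym/eqP; rewrite oner_eq0.
exists (N u) => // x; have [->|x0] := eqVneq x 0.
  by rewrite normr0 mulr0 is_norm_ge0.
have := Nu _ (mem_set (normS x x0)).
by rewrite NZ normfV normr_id mulrC ler_pdivlMr // normr_gt0.
Qed.


Lemma dual_ball_ubound p :
  has_ubound [set pairing p x | x in [set x | N x <= 1]].
Proof.
have [c c0 cN] := is_norm_ge.
exists (n%:R * `|p| / c) => _ [z /= Nz <-].
apply: le_trans (ler_norm _) _; apply: le_trans (normr_pairing_le _ _) _.
rewrite ler_wpM2l // ?mulr_ge0 // -div1r ler_pdivlMr // mulrC.
exact: le_trans (cN z) Nz.
Qed.

Lemma pairing_le_dual_norm p x : pairing p x <= dual_norm N p * N x.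
Proof.
have [c c0 cN] := is_norm_ge.
have [->|x0] := eqVneq x 0.
  by rewrite is_norm0 mulr0 -(scale0r 0) pairingZr mul0r.
have Nx : 0 < N x by rewrite (lt_le_trans _ (cN x)) // mulr_gt0 // normr_gt0.
rewrite -ler_pdivrMr // mulrC -pairingZr.
apply: ub_le_sup; first exact: dual_ball_ubound.
exists ((N x)^-1 *: x) => //=.
by rewrite NZ gtr0_norm ?invr_gt0 // mulVf // gt_eqF.
Qed.

End norm.
(** * Gradients, convexity and Bregman divergences *)

Section gradient.
Context {R : realType} {n : nat} (X : set 'rV[R]_n).

Lemma gradient_on_continuous (g : 'rV[R]_n -> R) dg :
  gradient_on X g dg -> {within X, continuous g}.
Proof.
move=> gdg; apply: locally_lipschitz_continuous_within => x Xx.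
exists (n%:R * `|dg x| + 1).
move: (gdg x Xx 1 ltr01); rewrite !near_withinE; apply: filterS => z gz Xz.
rewrite mulrDl mul1r -[X in `|X|](subrK (pairing (dg x) (z - x))).
apply: le_trans (ler_normD _ _) _; rewrite addrC.
apply: lerD (normr_pairing_le _ _) _; apply: le_trans (gz Xz) _.
by rewrite mul1r.
Qed.

(** First-order inequality on the segment from x to y, with a quadratic gain q:
    q = 0 for a convex function, and q = alpha / 2 * N (y - x) ^ 2 for a strongly
    convex one. *)
Lemma gradient_on_le (g : 'rV[R]_n -> R) dg (q : R) (x y : 'rV[R]_n) :
  gradient_on X g dg -> X x -> 0 <= q ->
  (forall t, 0 <= t <= 1 -> X (t *: y + (1 - t) *: x)) ->
  (forall t, 0 <= t <= 1 ->
     g (t *: y + (1 - t) *: x) <= t * g y + (1 - t) * g x - t * (1 - t) * q) ->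
  pairing (dg x) (y - x) + q <= g y - g x.
Proof.
move=> gdg Xx q0 Xt gt; apply/ler_addgt0Pr => e e0.
pose D := q + `|y - x| + 1.
have D0 : 0 < D by rewrite ltr_wpDl // addr_ge0.
have eD : 0 < e / D by exact: divr_gt0.
have := gdg x Xx _ eD.
rewrite near_withinE => /nbhs_normP[r /= r0 gr].
(* the step is short enough to stay in the neighbourhood, and at most e / D *)
pose t := Num.min (Num.min 1 (e / D)) (r / (2 * (`|y - x| + 1))).
have yx0 : 0 < `|y - x| + 1 by rewrite ltr_wpDl.
have t0 : 0 < t by rewrite !lt_min ltr01 eD divr_gt0 // mulr_gt0.
have t1 : t <= 1 by rewrite !ge_min lexx.
have teD : t <= e / D by rewrite !ge_min lexx orbT.
have tr : t * (2 * (`|y - x| + 1)) <= r.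
  by rewrite -ler_pdivlMr ?mulr_gt0 // ge_min lexx orbT.
have t01 : 0 <= t <= 1 by rewrite (ltW t0).
pose z := t *: y + (1 - t) *: x.
have zx : z - x = t *: (y - x).
  by rewrite /z scalerBl scale1r scalerBr addrCA addrAC subrr add0r addrC.
have nz : `|z - x| = t * `|y - x| by rewrite zx normrZ gtr0_norm.
have := gr z; rewrite /= distrC nz => /(_ _ (Xt t t01)).
have H1 : t * `|y - x| < r.
  have : t * (2 * (`|y - x| + 1)) = 2 * (t * `|y - x|) + 2 * t by ring.
  have : 0 <= t * `|y - x| by rewrite mulr_ge0 // ltW.
  lra.
move=> /(_ H1); rewrite zx pairingZr ler_norml => /andP[H2 _].
have H3 := gt t t01; rewrite -/z in H3.
(* dividing by the step *)
suff H4 : t * (pairing (dg x) (y - x) + q) <= t * (g y - g x + e).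
  by rewrite ler_pM2l in H4.
have H5 : e / D * (t * `|y - x|) + t * t * q <= t * e.
  have -> : t * e = e / D * (t * D) by field; rewrite gt_eqF.
  have : t * t * q <= e / D * (t * q).
    by rewrite [leRHS]mulrCA -mulrA ler_wpM2l ?(ltW t0) // ler_wpM2r.
  have : 0 <= e / D * t by rewrite mulr_ge0 ?(ltW t0) ?(ltW eD).
  rewrite /D; nra.
nra.
Qed.

End gradient.

Section mirror.
Context {R : realType} {n : nat} (N : 'rV[R]_n -> R) (hN : is_norm N).
Variables (X : set 'rV[R]_n) (psi : 'rV[R]_n -> R)
  (dpsi : 'rV[R]_n -> 'rV[R]_n) (alpha : R).
Hypothesis X_convex : convex_set X.
Hypothesis psi_grad : gradient_on X psi dpsi.
Hypothesis alpha_gt0 : 0 < alpha.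
Hypothesis psi_sc : strongly_convex_on N X alpha psi.

Lemma convex_set_segment x y t : X x -> X y -> 0 <= t <= 1 ->
  X (t *: x + (1 - t) *: y).
Proof.
move=> Xx Xy /andP[t0 t1].
have := X_convex x y (Itv01 t0 t1) (mem_set Xx) (mem_set Xy).
by rewrite inE.
Qed.

Lemma bregman_ge x y : X x -> X y ->
  alpha / 2 * N (x - y) ^+ 2 <= bregman psi dpsi x y.
Proof.
move=> Xx Xy; rewrite /bregman lerBrDl.
apply: (@gradient_on_le _ _ X) => //.
- by rewrite mulr_ge0 ?sqr_ge0 // divr_ge0 // ltW.
- by move=> t; exact: convex_set_segment.
- move=> t t01; apply: le_trans (psi_sc x y Xx Xy t t01) _.
  by rewrite le_eqVlt; apply/orP; left; apply/eqP; ring.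
Qed.

(** The sum of the two Bregman divergences between x and y is the pairing of
    dpsi x - dpsi y with x - y, at most a * dual_norm N p * N (x - y); subtracting
    the lower bound on the divergence of y from x and maximizing over N (x - y)
    gives the bound. *)
Lemma bregman_le_dual x y p a : X x -> X y -> 0 <= a ->
  dpsi x - dpsi y = a *: p ->
  bregman psi dpsi x y <= a ^+ 2 / (2 * alpha) * dual_norm N p ^+ 2.
Proof.
move=> Xx Xy a0 xyp.
have yx := bregman_ge y x Xy Xx.
have sym : bregman psi dpsi x y + bregman psi dpsi y x =
    a * pairing p (x - y).
  by rewrite -pairingZl -xyp /bregman !pairingBr !pairingBl; ring.
have := ler_wpM2l a0 (pairing_le_dual_norm N hN p (x - y)).
rewrite -sym; have -> : N (x - y) = N (y - x).
  by rewrite -(is_normN N hN) opprB.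
move: (N (y - x)) (dual_norm N p) yx => u v yx h.
have -> : a ^+ 2 / (2 * alpha) * v ^+ 2 = (a * v) ^+ 2 / (2 * alpha) by ring.
rewrite ler_pdivlMr ?mulr_gt0 //.
move: (bregman psi dpsi x y) (bregman psi dpsi y x) yx h => s s' yx h.
have : 0 <= (alpha * u - a * v) ^+ 2 by exact: sqr_ge0.
have : 0 <= 2 * alpha * (a * (v * u) - s - alpha / 2 * u ^+ 2).
  by rewrite mulr_ge0 ?mulr_ge0 ?(ltW alpha_gt0) //; lra.
lra.
Qed.

(** Strong monotonicity of dpsi, read as a Lipschitz bound for its inverse. *)
Lemma mirror_lipschitz : exists C, forall x y, X x -> X y ->
  `|x - y| <= C * `|dpsi x - dpsi y|.
Proof.
have [c c0 cN] := is_norm_ge N hN.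
have ac : 0 < alpha * c ^+ 2 by rewrite mulr_gt0 // exprn_gt0.
exists (n%:R / (alpha * c ^+ 2)) => x y Xx Xy.
have [->|xy] := eqVneq x y; first by rewrite !subrr !normr0 mulr0.
rewrite mulrAC ler_pdivlMr // -(ler_pM2r (_ : 0 < `|x - y|)); last first.
  by rewrite normr_gt0 subr_eq0.
apply: le_trans (normr_pairing_le _ _); apply: le_trans (ler_norm _).
have -> : pairing (dpsi x - dpsi y) (x - y) =
    bregman psi dpsi x y + bregman psi dpsi y x.
  by rewrite /bregman !pairingBr !pairingBl; ring.
apply: le_trans (lerD (bregman_ge x y Xx Xy) (bregman_ge y x Xy Xx)).
rewrite -[in N (y - x)]opprB (is_normN N hN).
have : (c * `|x - y|) ^+ 2 <= N (x - y) ^+ 2.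
  by rewrite ler_sqr ?nnegrE ?cN ?mulr_ge0 ?(is_norm_ge0 N hN) // ltW.
rewrite exprMn => h.
have : 0 <= alpha * (N (x - y) ^+ 2 - c ^+ 2 * `|x - y| ^+ 2).
  by rewrite mulr_ge0 ?(ltW alpha_gt0) // subr_ge0.
move: (N _) (`|x - y|) => u v; lra.
Qed.

Lemma inverse_mirror_continuous (m : 'rV[R]_n -> 'rV[R]_n) i :
  (forall z, X z -> m (dpsi z) = z) ->
  {within dpsi @` X, continuous (fun p => m p 0 i)}.
Proof.
move=> mK; have [C XC] := mirror_lipschitz.
apply: locally_lipschitz_continuous_within => _ [x Xx <-]; exists C.
rewrite near_withinE; apply: nearW => _ [y Xy <-]; rewrite !mK //.
apply: le_trans (XC _ _ Xy Xx).
by have := coord_le_norm (y - x) i; rewrite !mxE.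
Qed.

End mirror.

Lemma lipschitz_gradient_continuous {R : realType} {n : nat}
    (N : 'rV[R]_n -> R) (X : set 'rV[R]_n) L (df : 'rV[R]_n -> 'rV[R]_n) i :
  is_norm N -> lipschitz_gradient_on N X L df ->
  {within X, continuous (fun x => df x 0 i)}.
Proof.
move=> hN dfL; have [C C0 NC] := is_norm_le N hN.
apply: locally_lipschitz_continuous_within => x Xx.
exists (`|L| * C * N (delta_mx 0 i)).
rewrite near_withinE; apply: nearW => z Xz.
have le u v : X u -> X v ->
    df u 0 i - df v 0 i <= `|L| * C * N (delta_mx 0 i) * `|u - v|.
  move=> Xu Xv; rewrite -!pairing_delta -pairingBl.
  apply: le_trans (pairing_le_dual_norm N hN _ _) _.
  rewrite mulrAC; apply: ler_wpM2r; first exact: is_norm_ge0.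
  apply: le_trans (dfL u v Xu Xv) _; rewrite -mulrA.
  apply: (@le_trans _ _ (`|L| * N (u - v))).
    by apply: ler_wpM2r; [exact: is_norm_ge0|exact: ler_norm].
  by rewrite ler_wpM2l.
by rewrite ler_norml le // andbT lerNl opprB distrC le.
Qed.

(** A bounded Bregman divergence bounds the set X, by strong convexity. *)
Lemma bregman_bounded_set {R : realType} {n : nat} (N : 'rV[R]_n -> R)
    (X : set 'rV[R]_n) psi dpsi (alpha M : R) (y : 'rV[R]_n) :
  is_norm N -> convex_set X -> gradient_on X psi dpsi -> 0 < alpha ->
  strongly_convex_on N X alpha psi -> X y ->
  (forall x, X x -> bregman psi dpsi x y <= M) ->
  exists C, forall x, X x -> `|x| <= C.
Proof.
move=> hN cX gpsi a0 scpsi Xy BM; have [c c0 cN] := is_norm_ge N hN.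
exists (`|y| + (2 * M / alpha + 1) / c) => x Xx.
rewrite -{1}(subrK y x) addrC; apply: le_trans (ler_normD _ _) _.
rewrite lerD2l ler_pdivlMr // mulrC; apply: le_trans (cN _) _.
have := le_trans (bregman_ge N X psi dpsi alpha cX gpsi a0 scpsi x y Xx Xy) (BM x Xx).
move: (N _) => u uM.
have : u ^+ 2 <= 2 * M / alpha by rewrite ler_pdivlMr //; lra.
have : 0 <= (u - 1 / 2) ^+ 2 by exact: sqr_ge0.
lra.
Qed.

Lemma convex_function_gradient_le {R : realType} {n : nat} (X : set 'rV[R]_n)
    (f : 'rV[R]_n -> R) df x v :
  convex_set X -> convex_function X f -> gradient_on X f df -> X x -> X v ->
  f x + pairing (df x) (v - x) <= f v.
Proof.
move=> cX cf gf Xx Xv; rewrite -lerBrDl -[leLHS]addr0.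
apply: (gradient_on_le X) => // t t01.
  exact: convex_set_segment.
rewrite mulr0 subr0; case/andP: t01 => t0 t1.
exact: (cf (Itv01 t0 t1) v x (mem_set Xv) (mem_set Xx)).
Qed.

(** * Parameters and energy of the iteration *)

Section parameters.
Context {R : realType}.
Implicit Types k : nat.

Lemma asmd_A_gt0 k : 0 < asmd_A R k.
Proof. by case: k => [|k] /=; rewrite divr_gt0 ?mulr_gt0. Qed.

Lemma asmd_A_diff k : 0 <= asmd_A R k.+1 - asmd_A R k <= k.+1%:R.
Proof.
case: k => [|k]; first by rewrite /asmd_A; apply/andP; split; lra.
have -> : asmd_A R k.+2 - asmd_A R k.+1 = k.+2%:R.
  rewrite /asmd_A -[k.+3]addn1 -[k.+2]addn1 -[k.+1]addn1 !natrD; lra.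
by rewrite ler0n lexx.
Qed.

(** The averaging weights, in terms of the energy weights. *)
Lemma asmd_x_weights k :
  asmd_tau R k / (asmd_tau R k + 1) =
    (asmd_A R k.+1 - asmd_A R k) / asmd_A R k.+1 /\
  1 / (asmd_tau R k + 1) = asmd_A R k / asmd_A R k.+1.
Proof.
have A0 := asmd_A_gt0 k; have A1 := asmd_A_gt0 k.+1.
have -> : asmd_tau R k + 1 = asmd_A R k.+1 / asmd_A R k.
  by rewrite /asmd_tau; field; rewrite gt_eqF.
by rewrite /asmd_tau; split; field; rewrite !gt_eqF.
Qed.

Lemma asmd_sE k : asmd_s R k = k.+1%:R * Num.sqrt k.+1%:R.
Proof.
rewrite /asmd_s; have -> : 3 / 2 = 1 + 2^-1 :> R by lra.
by rewrite powRD ?powRr1 ?powR12_sqrt // ?pnatr_eq0 ?implybT.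
Qed.

Lemma asmd_s_gt0 k : 0 < asmd_s R k.
Proof. by rewrite asmd_sE mulr_gt0 // sqrtr_gt0. Qed.

Lemma asmd_s_le k : asmd_s R k <= asmd_s R k.+1.
Proof. by rewrite !asmd_sE ler_pM ?sqrtr_ge0 ?ler_sqrt ?ler_nat. Qed.

Lemma sum_asmd_step_le k :
  \sum_(j < k) (asmd_A R j.+1 - asmd_A R j) ^+ 2 / asmd_s R j <= asmd_s R k.
Proof.
elim: k => [|k IH]; first by rewrite big_ord0 ltW // asmd_s_gt0.
rewrite big_ord_recr /=; apply: le_trans (lerD IH _) _.
  apply: (_ : _ <= Num.sqrt k.+1%:R); rewrite ler_pdivrMr ?asmd_s_gt0 //.
  have /andP[a0 ak] := asmd_A_diff k.
  rewrite asmd_sE mulrCA -expr2 sqr_sqrtr // -expr2 ler_sqr ?nnegrE //.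
rewrite !asmd_sE -[X in _ + X]mul1r -mulrDl natr1.
by rewrite ler_wpM2l // ler_sqrt // ler_nat.
Qed.

End parameters.

(** One iteration, for a fixed outcome, with g the stochastic gradient at the new
    point x'. The energy A * (f x - f xs) + s * B (xs, z) increases by at most
    the cost (s' - s) * M of changing the scale s, the cost (A' - A) * K of the
    approximation error u, a second-order term in g, and a first-order term in
    the noise g - df x', which has mean zero. *)
Lemma asmd_step {R : realType} {n : nat} (N : 'rV[R]_n -> R)
    (X : set 'rV[R]_n) (psi f : 'rV[R]_n -> R) (dpsi df : 'rV[R]_n -> 'rV[R]_n)
    (alpha M K A A' s s' : R) (xs x x' z z' u g : 'rV[R]_n) :
  is_norm N -> convex_set X -> gradient_on X psi dpsi -> 0 < alpha ->
  strongly_convex_on N X alpha psi ->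
  (forall v, X v -> f x' + pairing (df x') (v - x') <= f v) ->
  X xs -> X x -> X z -> X z' ->
  0 < A -> A <= A' -> 0 < s -> s <= s' ->
  A' *: x' = (A' - A) *: (z + u) + A *: x ->
  dpsi z' = dpsi z - ((A' - A) / s) *: g ->
  pairing (df x') u <= K -> bregman psi dpsi xs z' <= M ->
  A' * (f x' - f xs) + s' * bregman psi dpsi xs z' <=
  A * (f x - f xs) + s * bregman psi dpsi xs z +
  (s' - s) * M + (A' - A) * K +
  ((A' - A) ^+ 2 / s / (2 * alpha) * dual_norm N g ^+ 2 +
   (A' - A) * pairing (g - df x') (xs - z)).
Proof.
move=> hN cX gpsi a0 scpsi fx' Xs Xx Xz Xz' A0 AA' s0 ss' xE zE uK BM.
have a_ge0 : 0 <= A' - A by rewrite subr_ge0.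
have as_ge0 : 0 <= (A' - A) / s by rewrite divr_ge0 // ltW.
(* three-point identity of the Bregman divergence *)
have H1 : bregman psi dpsi xs z' = bregman psi dpsi xs z +
    bregman psi dpsi z z' + (A' - A) / s * pairing g (xs - z).
  rewrite /bregman zE !pairingBl !pairingBr !pairingZl; ring.
have zz' : dpsi z - dpsi z' = ((A' - A) / s) *: g.
  by rewrite zE opprB addrC subrK.
have H2 := bregman_le_dual N hN X psi dpsi alpha cX gpsi a0 scpsi _ _ _ _
  Xz Xz' as_ge0 zz'.
have H3 : s * bregman psi dpsi xs z' <= s * bregman psi dpsi xs z +
    (A' - A) ^+ 2 / s / (2 * alpha) * dual_norm N g ^+ 2 +
    (A' - A) * pairing g (xs - z).
  rewrite H1; move: (bregman psi dpsi z z') (bregman psi dpsi xs z) H2.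
  move=> b b' H2.
  rewrite !mulrDr; have -> : s * ((A' - A) / s * pairing g (xs - z)) =
    (A' - A) * pairing g (xs - z) by field; rewrite gt_eqF.
  rewrite lerD2r lerD2l; apply: le_trans (ler_wpM2l (ltW s0) H2) _.
  rewrite le_eqVlt; apply/orP; left; apply/eqP; field.
  by rewrite !gt_eqF.
have H4 : (s' - s) * bregman psi dpsi xs z' <= (s' - s) * M.
  by rewrite ler_wpM2l // subr_ge0.
have H5 : (A' - A) * pairing (df x') u <= (A' - A) * K by rewrite ler_wpM2l.
have := congr1 (pairing (df x')) xE.
move=> H6; rewrite !(pairingDr, pairingZr) in H6.
have := ler_wpM2l a_ge0 (fx' xs Xs); have := ler_wpM2l (ltW A0) (fx' x Xx).
rewrite !pairingBr !pairingBl in H3 *.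
lra.
Qed.

Lemma asmd_AE {R : realType} k : (0 < k)%N ->
  asmd_A R k = k%:R * (k%:R + 1) / 2.
Proof. by case: k => // k _; rewrite /asmd_A natr1. Qed.

(** The weights A grow faster than the scales s, so a negative K would drive the
    bound below zero. *)
Lemma asmd_bound_constant_ge0 {R : realType} (e b K : R) : 0 <= e -> 0 <= b ->
  (forall k, 0 <= e + asmd_s R k * b + (asmd_A R k - 1 / 2) * K) -> 0 <= K.
Proof.
move=> e0 b0 h; rewrite leNgt; apply/negP => K0.
have K1 : 0 < - K by rewrite oppr_gt0.
(* along k + 1 = m ^ 2 the two sides grow like m ^ 3 and m ^ 4 *)
pose m := (Num.bound (4 * (b + e + 1) / - K)).+2.
have mK : 4 * (b + e + 1) <= m%:R * - K.
  rewrite -ler_pdivrMr //; apply: ltW; apply: lt_le_trans (archi_boundP _) _.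
    by rewrite divr_ge0 ?(ltW K1) // mulr_ge0 // !addr_ge0.
  by rewrite ler_nat /m; exact: leqW (leqnSn _).
have m2 : 2 <= m%:R :> R by rewrite ler_nat.
have := h (m ^ 2).-1.
have mE : (m ^ 2).-1.+1%:R = m%:R ^+ 2 :> R.
  by rewrite prednK ?expn_gt0 // natrX.
have mE' : (m ^ 2).-1%:R = m%:R ^+ 2 - 1 :> R.
  by rewrite -mE -natr1 addrK.
rewrite asmd_sE mE sqrtr_sqr ger0_norm // asmd_AE; last first.
  by rewrite -ltnS prednK ?expn_gt0 // (@ltn_exp2l _ 0).
rewrite mE' subrK; move: (m%:R : R) m2 mK => u u2 uK.
have u3 : 0 <= u ^+ 3 by rewrite exprn_ge0 // (le_trans _ u2).
have : 0 <= u ^+ 3 * (u * - K - 4 * (b + e + 1)).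
  by rewrite mulr_ge0 // subr_ge0.
have u8 : 8 <= u ^+ 3.
  have -> : 8 = 2 ^+ 3 :> R by ring.
  by rewrite lerXn2r // nnegrE // (le_trans _ u2).
have : 0 <= (u ^+ 3 - 8) * (e + 1) by rewrite mulr_ge0 ?subr_ge0 // addr_ge0.
have : 0 <= - K * ((u ^+ 2 - 4) * u ^+ 2 + 2 * (u ^+ 2 - 4)).
  have : 0 <= u ^+ 2 - 4 by nra.
  by move=> u4; rewrite mulr_ge0 ?(ltW K1) // addr_ge0 // mulr_ge0 // sqr_ge0.
lra.
Qed.

Lemma asmd_rate_bigO {R : realType} (e b : R) : 0 <= e -> 0 <= b ->
  ((fun k => e / asmd_A R k + k.+1%:R `^ (3 / 2) / asmd_A R k * b) : nat -> R^o)
  =O_\oo (fun k => k%:R ^- 2 + k%:R `^ (- (1 / 2)) : R^o).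
Proof.
move=> e0 b0; apply/eqO_exP; exists (2 * e + 4 * b + 1).
  by rewrite ltr_wpDl // addr_ge0 // mulr_ge0.
exists 1%N => // k /= k1; rewrite -/(asmd_s R k).
have k0 : 0 < k%:R :> R by rewrite ltr0n.
have r0 : 0 < Num.sqrt k%:R :> R by rewrite sqrtr_gt0.
have rk : Num.sqrt k%:R ^+ 2 = k%:R :> R by rewrite sqr_sqrtr.
have rE : k%:R `^ (- (1 / 2)) = (Num.sqrt k%:R)^-1 :> R.
  by rewrite powRN div1r powR12_sqrt.
have sk : Num.sqrt k.+1%:R <= 2 * Num.sqrt k%:R :> R.
  rewrite -ler_sqr ?nnegrE ?mulr_ge0 ?sqrtr_ge0 // exprMn !sqr_sqrtr //.
  by rewrite -natrX -natrM ler_nat; lia.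
rewrite rE asmd_sE asmd_AE // natr1.
have k10 : 0 < k.+1%:R :> R by [].
rewrite !ger0_norm; last 2 first.
- by rewrite addr_ge0 // ?invr_ge0 ?exprn_ge0 ?sqrtr_ge0.
- by rewrite addr_ge0 // ?mulr_ge0 ?divr_ge0 ?mulr_ge0 ?sqrtr_ge0.
have H1 : e / (k%:R * k.+1%:R / 2) <= 2 * e * k%:R ^- 2.
  rewrite ler_pdivrMr ?divr_gt0 ?mulr_gt0 //.
  have -> : 2 * e * k%:R ^- 2 * (k%:R * k.+1%:R / 2) = e * (k.+1%:R / k%:R).
    by field; rewrite gt_eqF.
  by rewrite ler_peMr // ler_pdivlMr // mul1r ler_nat.
have H2 : k.+1%:R * Num.sqrt k.+1%:R / (k%:R * k.+1%:R / 2) * b <=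
    4 * b * (Num.sqrt k%:R)^-1.
  have -> : k.+1%:R * Num.sqrt k.+1%:R / (k%:R * k.+1%:R / 2) * b =
      Num.sqrt k.+1%:R * (2 * b / k%:R) by field; rewrite !gt_eqF.
  apply: le_trans (ler_wpM2r _ sk) _.
    by rewrite divr_ge0 // mulr_ge0.
  rewrite -[X in 2 * b / X]rk le_eqVlt; apply/orP; left; apply/eqP.
  by field; rewrite gt_eqF.
apply: le_trans (lerD H1 H2) _.
have : 0 <= k%:R ^- 2 :> R by rewrite invr_ge0 exprn_ge0.
have : 0 <= (Num.sqrt k%:R)^-1 :> R by rewrite invr_ge0 sqrtr_ge0.
move: (k%:R ^- 2) (_^-1) => p q q0 p0.
have : 0 <= e * q by rewrite mulr_ge0.
have : 0 <= b * p by rewrite mulr_ge0.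
lra.
Qed.

(** * Adapted iterates and oracle noise *)

(** The majorant h is only almost surely nonnegative; its positive part is
    compared with g. *)
Lemma ge0_ae_le_expectation {R : realType} {d : measure_display}
    {T : measurableType d} (P : probability T R) (g h : T -> R) :
  measurable_fun setT g -> (forall w, 0 <= g w) ->
  P.-integrable setT (EFin \o h) -> {ae P, forall w, g w <= h w} ->
  ('E_P[g] <= \int[P]_w (h w)%:E)%E.
Proof.
move=> mg g0 ih gh; rewrite unlock.
have mh : measurable_fun setT (EFin \o h) by case/integrableP: ih.
have mhp : measurable_fun setT ((EFin \o h)^\+)%E by exact: measurable_funepos.
apply: (@le_trans _ _ (\int[P]_w ((EFin \o h)^\+ w))%E).
  apply: ae_ge0_le_integral => //.
  - by move=> w _; rewrite lee_fin.
  - exact/measurable_EFinP.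
  - by apply: filterS gh => w gw _; rewrite funeposE le_max lee_fin gw.
rewrite le_eqVlt; apply/orP; left; apply/eqP.
apply: ae_eq_integral => //; apply: filterS gh => w gw _.
rewrite funeposE; apply/max_idPl; rewrite lee_fin; exact: le_trans (g0 w) gw.
Qed.

Lemma ae_le_integrable {R : realType} {d : measure_display}
    {T : measurableType d} (P : probability T R) (f g : T -> R) :
  P.-integrable setT (EFin \o f) -> P.-integrable setT (EFin \o g) ->
  {ae P, forall w, f w <= g w} ->
  (\int[P]_w (f w)%:E <= \int[P]_w (g w)%:E)%E.
Proof.
move=> fi gi fg; rewrite -sube_ge0 ?integrable_fin_num //.
rewrite -(integralB measurableT gi fi).
have mgf : measurable_fun setT (fun w => ((EFin \o g) w - (EFin \o f) w)%E).
  by apply: emeasurable_funB; [case/integrableP: gi|case/integrableP: fi].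
rewrite (ae_eq_integral (fun w => `|(EFin \o g) w - (EFin \o f) w|%E)) //.
- exact: integral_ge0.
- exact: measurableT_comp.
- apply: filterS fg => w fgw _ /=.
  by rewrite ger0_norm // subr_ge0.
Qed.

(** In this section m stands for the inverse mirror map and eta k for the noise
    entering at iteration k; a, b and c are the coefficients of the iteration.
    Only the continuity of m on the image of X under dpsi is known, hence the
    dual iterates have to be used through the fact that they lie in that image. *)
Section iterates.
Context {R : realType} {n : nat} {d d' : measure_display}
  {T : measurableType d} {Xi : measurableType d'} (P : probability T R).
Variables (X : set 'rV[R]_n) (dpsi m : 'rV[R]_n -> 'rV[R]_n)
  (eta : nat -> T -> Xi) (G : 'rV[R]_n -> Xi -> 'rV[R]_n)
  (U : 'rV[R]_n -> 'rV[R]_n) (x0 : 'rV[R]_n) (x y : nat -> T -> 'rV[R]_n)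
  (a b c : nat -> R).
Hypothesis X_closed : closed X.
Hypothesis m_continuous : forall i,
  {within dpsi @` X, continuous (fun p => m p 0 i)}.
Hypothesis m_range : forall p, X (m p).
Hypothesis m_right : forall k w, dpsi (m (y k w)) = y k w.
Hypothesis G_meas : measurable_fun (X `*` setT : set (borel_rV R n * Xi))
  (fun p : borel_rV R n * Xi => G p.1 p.2 : borel_rV R n).
Hypothesis U_meas : measurable_fun setT (U : borel_rV R n -> borel_rV R n).
Hypothesis x_init : forall w, x 0%N w = x0.
Hypothesis y_init : forall w, y 0%N w = dpsi x0.
Hypothesis x_step : forall k w,
  x k.+1 w = a k *: (m (y k w) + U (y k w)) + b k *: x k w.
Hypothesis y_step : forall k w,
  y k.+1 w = y k w - c k *: G (x k.+1 w) (eta k w).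
Hypothesis x_in : forall k w, X (x k w).

Lemma measurable_mirror_iterate (e : measure_display) (S : measurableType e)
    (v : S -> T) k i :
  measurable_fun setT (y k \o v : S -> borel_rV R n) ->
  measurable_fun setT (fun w => m (y k (v w)) 0 i).
Proof.
move=> my.
apply: (measurable_comp_continuous_within R n _ S _ _ (y k \o v)
  (m_continuous i)) => //.
by move=> w; exists (m (y k (v w))); rewrite /= ?m_right.
Qed.

(** The source S is arbitrary so that the lemma applies to the sample space
    under each of the sigma-algebras of the pasts. *)
Lemma measurable_x_step k (e : measure_display) (S : measurableType e)
    (v : S -> T) :
  measurable_fun setT (x k \o v : S -> borel_rV R n) ->
  measurable_fun setT (y k \o v : S -> borel_rV R n) ->
  measurable_fun setT (x k.+1 \o v : S -> borel_rV R n).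
Proof.
move=> mx my; apply: measurable_rV => i.
have -> : (fun w => (x k.+1 \o v) w 0 i) = (fun w =>
    a k * (m (y k (v w)) 0 i + U (y k (v w)) 0 i) + b k * x k (v w) 0 i).
  by apply/funext => w; rewrite /= x_step !mxE.
apply: measurable_funD; apply: measurable_funM => //.
  apply: measurable_funD; first exact: measurable_mirror_iterate.
  apply: (measurableT_comp (measurable_coord R n i)).
  exact: (measurableT_comp U_meas my).
exact: (measurableT_comp (measurable_coord R n i) mx).
Qed.

Lemma measurable_oracle (e : measure_display) (S : measurableType e)
    (v : S -> 'rV[R]_n) (xi : S -> Xi) i :
  measurable_fun setT (v : S -> borel_rV R n) -> measurable_fun setT xi ->
  (forall w, X (v w)) ->
  measurable_fun setT (fun w => G (v w) (xi w) 0 i).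
Proof.
move=> mv mxi Xv; apply: (measurableT_comp (measurable_coord R n i)).
apply: (@measurable_comp _ _ _ S (borel_rV R n * Xi)%type (borel_rV R n)
  (X `*` setT) (fun p => G p.1 p.2) setT (fun w => (v w, xi w))) => //.
- by apply: measurableX => //; exact: closed_measurable_rV.
- by move=> _ [w _ <-]; split=> //=.
- exact: measurable_fun_pair.
Qed.

(** The iterates of index k are adapted to the noise of the first k iterations. *)
Lemma iterates_measurable_past k :
  measurable_fun setT (x k : past eta k -> borel_rV R n) /\
  measurable_fun setT (y k : past eta k -> borel_rV R n).
Proof.
elim: k => [|k [mx my]].
  split.
    by have -> : x 0%N = cst x0 by exact/funext.
  by have -> : y 0%N = cst (dpsi x0) by exact/funext.
have mid := measurable_past_succ eta k.
have mx' : measurable_fun setT (x k : past eta k.+1 -> borel_rV R n).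
  exact: (measurableT_comp mx mid).
have my' : measurable_fun setT (y k : past eta k.+1 -> borel_rV R n).
  exact: (measurableT_comp my mid).
have mx1 : measurable_fun setT (x k.+1 : past eta k.+1 -> borel_rV R n).
  exact: (measurable_x_step k _ (past eta k.+1) id).
split=> //; apply: measurable_rV => i.
have -> : (fun w => y k.+1 w 0 i) =
    (fun w => y k w 0 i - c k * G (x k.+1 w) (eta k w) 0 i).
  by apply/funext => w; rewrite y_step !mxE.
apply: measurable_funB.
  exact: (measurableT_comp (measurable_coord R n i) my').
apply: measurable_funM => //; apply: measurable_oracle => //.
exact: measurable_past_last.
Qed.

(** The next primal iterate does not use the noise of the current iteration. *)
Lemma next_iterate_measurable_past k :
  measurable_fun setT (x k.+1 : past eta k -> borel_rV R n).
Proof.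
have [mx my] := iterates_measurable_past k.
exact: (measurable_x_step k _ (past eta k) id).
Qed.

Hypothesis eta_iid : iid P eta.
Variables (g : 'rV[R]_n -> R) (i : 'I_n) (h : 'rV[R]_n -> R) (C : R).
Hypothesis x0_in : X x0.
Hypothesis g_continuous : {within X, continuous g}.
Hypothesis h_continuous : {within X, continuous h}.
Hypothesis h_bounded : forall z, X z -> `|h z| <= C.

(** The oracle noise is orthogonal to every continuous function h of the mirror
    point m (y k), although the oracle is only unbiased conditionally on the
    point x (k + 1), which does not determine m (y k). *)
Lemma oracle_noise_mean0 k :
  is_cond_expectation P (sigma_of (x k.+1))
    (fun w => G (x k.+1 w) (eta k w) 0 i) (fun w => g (x k.+1 w)) ->
  P.-integrable setT (fun w => ((G (x k.+1 w) (eta k w) 0 i - g (x k.+1 w)) *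
     h (m (y k w)))%:E) /\
  (\int[P]_w ((G (x k.+1 w) (eta k w) 0 i - g (x k.+1 w)) *
     h (m (y k w)))%:E = 0)%E.
Proof.
move=> [iG ig _ condE].
have [eta_meas _ _] := eta_iid.
have mid := measurable_to_past eta eta_meas k.
pose V : {mfun T >-> past eta k} := mfun_Sub (mem_set mid).
pose xik : {mfun T >-> Xi} := mfun_Sub (mem_set (eta_meas k)).
(* r retracts the space onto X, where oracle and gradient are measurable *)
pose r (v : borel_rV R n) : borel_rV R n := if v \in X then v else x0.
have mr : measurable_fun setT r.
  apply: measurable_fun_ifT => //; apply: (measurable_fun_bool true).
  rewrite setTI; have -> : (fun v => v \in X) @^-1` [set true] = X.
    by apply/seteqP; split=> v /=; [move/set_mem|move/mem_set].
  exact: closed_measurable_rV.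
have Xr v : X (r v) by rewrite /r; case: ifPn => // /set_mem.
have rx w : r (x k.+1 w) = x k.+1 w by rewrite /r mem_set.
pose Gam (p : borel_rV R n * Xi) := G (r p.1) p.2 0 i - g (r p.1).
have mGam : measurable_fun setT Gam.
  apply: measurable_funB.
    by apply: measurable_oracle => //; exact: measurableT_comp.
  apply: (measurable_comp_continuous_within R n _ _ _ _
    (fun p : borel_rV R n * Xi => r p.1) g_continuous) => //.
  exact: measurableT_comp.
have GamE w : Gam (x k.+1 w, eta k w) =
    G (x k.+1 w) (eta k w) 0 i - g (x k.+1 w).
  by rewrite /Gam /= rx.
have [_ my] := iterates_measurable_past k.
have mh : measurable_fun setT (fun w : past eta k => h (m (y k w))).
  apply: (measurable_comp_continuous_within R n _ (past eta k) _ _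
    (fun w => m (y k w)) h_continuous) => //.
  apply: measurable_rV => j.
  exact: (measurable_mirror_iterate _ (past eta k) id).
have iGam : P.-integrable setT (fun w => (Gam (x k.+1 w, eta k w))%:E).
  rewrite (_ : (fun w => _) = (fun w => (G (x k.+1 w) (eta k w) 0 i)%:E -
     (g (x k.+1 w))%:E)%E); last by apply/funext => w; rewrite GamE EFinB.
  exact: integrableB.
split.
  apply: (integrable_mul_bounded P _ _ C) => [||w].
  - by move: iGam; under eq_fun do rewrite GamE.
  - exact: (measurableT_comp mh mid).
  - exact: h_bounded.
have := independent_mean0 P V xik (past_independent P eta eta_meas k eta_iid)
  _ Gam _ C (next_iterate_measurable_past k) mGam mh
  (fun w => h_bounded _ (m_range _)) iGam.
rewrite /=; under eq_integral do rewrite GamE; apply=> B mB.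
have mBx : measurable (x k.+1 @^-1` B).
  rewrite -[Y in measurable Y]setTI.
  exact: (measurableT_comp (next_iterate_measurable_past k) mid).
under eq_integral do rewrite GamE EFinB.
rewrite integralB //; last 2 first.
- exact: integrableS iG.
- exact: integrableS ig.
rewrite condE; last by exists B => //; rewrite setTI.
rewrite subee // integrable_fin_num //.
exact: integrableS ig.
Qed.

End iterates.

Lemma cond_expectation_bounded_le {R : realType} {d : measure_display}
    {T : measurableType d} (P : probability T R) (S : set_system T)
    (Z W : T -> R) (c : R) :
  S setT -> is_cond_expectation P S Z W -> {ae P, forall w, W w <= c} ->
  (\int[P]_w (Z w)%:E <= c%:E)%E.
Proof.
move=> ST [_ iW _ ZW] Wc; rewrite ZW //.
have ic : P.-integrable setT (EFin \o cst c).
  by apply: finite_measure_integrable_cst.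
apply: le_trans (ae_le_integrable P W (cst c) iW ic Wc) _.
by have := expectation_cst P c; rewrite unlock => ->.
Qed.

Lemma telescoped_energy_le {R : realType} (E s A q : nat -> R) (M K : R) :
  (forall j, E j.+1 <= E j + (s j.+1 - s j) * M + (A j.+1 - A j) * K + q j) ->
  forall k, E k <= E 0%N + (s k - s 0%N) * M + (A k - A 0%N) * K +
    \sum_(j < k) q j.
Proof.
move=> h; elim=> [|k IH]; first by rewrite big_ord0 !subrr !mul0r !addr0.
rewrite big_ord_recr /=; have := h k; lra.
Qed.

(** * Convergence in expectation *)

Theorem theorem3 (R : realType) (n : nat)
  (* the norm, the constraint set, and the mirror potential with its gradient *)
  (N : 'rV[R]_n -> R) (X : set 'rV[R]_n)
  (psi : 'rV[R]_n -> R) (dpsi : 'rV[R]_n -> 'rV[R]_n) (alpha : R)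
  (* the objective with its gradient *)
  (f : 'rV[R]_n -> R) (df : 'rV[R]_n -> 'rV[R]_n) (Lf : R) (xs : 'rV[R]_n)
  (* probability space, noise, oracle, approximation error, iterates *)
  (d d' : measure_display) (T : measurableType d) (Xi : measurableType d')
  (P : probability T R) (xi : nat -> T -> Xi)
  (G : 'rV[R]_n -> Xi -> 'rV[R]_n) (U : 'rV[R]_n -> 'rV[R]_n)
  (x0 : 'rV[R]_n) (x y : nat -> T -> 'rV[R]_n)
  (sigma Mpsi K : R)
  (hN : is_norm N)
  (X_closed : closed X) (X_convex : convex_set X)
  (* psi is C^1 and alpha-strongly convex on X *)
  (psi_grad : gradient_on X psi dpsi) (psi_C1 : {within X, continuous dpsi})
  (alpha_gt0 : 0 < alpha) (psi_sc : strongly_convex_on N X alpha psi)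
  (* inverse mirror map: grad psi^* = (grad psi)^-1 with values in X; the right
     inverse identity is required at the dual iterates only, since required on
     the whole dual it would contradict the finiteness of Mpsi below *)
  (mirror_range : forall p, X (inverse_mirror_map X psi p))
  (mirror_left : forall z, X z -> inverse_mirror_map X psi (dpsi z) = z)
  (mirror_right : forall k w, dpsi (inverse_mirror_map X psi (y k w)) = y k w)
  (* f is convex and differentiable, with Lipschitz gradient and minimizer xs *)
  (f_convex : convex_function X f) (f_grad : gradient_on X f df)
  (f_lip : lipschitz_gradient_on N X Lf df)
  (xs_in : X xs) (xs_min : forall z, X z -> f xs <= f z)
  (* measurability of the data, and i.i.d. noise xi 1, xi 2, ... *)
  (G_meas : measurable_fun (X `*` setT : set (borel_rV R n * Xi))
     (fun p : borel_rV R n * Xi => G p.1 p.2 : borel_rV R n))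
  (U_meas : measurable_fun setT (U : borel_rV R n -> borel_rV R n))
  (xi_iid : iid P (fun k => xi k.+1))
  (* the iterations *)
  (x0_in : X x0)
  (x_init : forall w, x 0%N w = x0) (y_init : forall w, y 0%N w = dpsi x0)
  (x_step : forall k w, x k.+1 w =
     (asmd_tau R k / (asmd_tau R k + 1)) *: (inverse_mirror_map X psi (y k w) + U (y k w)) +
     (1 / (asmd_tau R k + 1)) *: x k w)
  (y_step : forall k w, y k.+1 w =
     y k w - ((asmd_A R k.+1 - asmd_A R k) / asmd_s R k) *:
               G (x k.+1 w) (xi k.+1 w))
  (x_in : forall k w, X (x k w))
  (* bounded approximation error *)
  (U_bounded : exists C : R, forall k, {ae P, forall w, N (U (y k w)) <= C})
  (* unbiased oracle with bounded second moment *)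
  (G_unbiased : forall k (i : 'I_n),
     is_cond_expectation P (sigma_of (x k.+1))
       (fun w => G (x k.+1 w) (xi k.+1 w) 0 i)
       (fun w => df (x k.+1 w) 0 i))
  (G_moment : forall k, exists W : T -> R,
     is_cond_expectation P (sigma_of (x k.+1))
       (fun w => dual_norm N (G (x k.+1 w) (xi k.+1 w)) ^+ 2) W /\
     {ae P, forall w, W w <= sigma ^+ 2})
  (Mpsi_gt0 : 0 < Mpsi)
  (Mpsi_sup : ereal_sup [set (bregman psi dpsi z z')%:E | z in X & z' in X]
              = Mpsi%:E)
  (hK : forall k, {ae P, forall w, pairing (df (x k.+1 w)) (U (y k w)) <= K}) :
  let E0 : R := fine (asmd_energy P X f psi dpsi xs x y 0) in
  let rate : nat -> R := fun k =>
    E0 / asmd_A R k +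
    k.+1%:R `^ (3 / 2) / asmd_A R k *
      (Mpsi + (8 * Lf ^+ 2 * Mpsi + 2 * alpha * sigma ^+ 2 +
               4 * dual_norm N (df xs) ^+ 2) / alpha ^+ 2) in
  (forall k, ('E_P[fun w => (f (x k w) - f xs)%R] <= (K + rate k)%:E)%E) /\
  (rate : nat -> R^o) =O_\oo
    (fun k => k%:R ^- 2 + k%:R `^ (- (1 / 2)) : R^o).
Proof.
move=> E0 rate.
pose m := inverse_mirror_map X psi.
pose eta k := xi k.+1.
pose A := asmd_A R; pose s := asmd_s R.
pose a k := A k.+1 - A k.
have a_ge0 k : 0 <= a k by have /andP[] := asmd_A_diff (R := R) k.
have A_gt0 k : 0 < A k by exact: asmd_A_gt0.
have s_gt0 k : 0 < s k by exact: asmd_s_gt0.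
have BM z z' : X z -> X z' -> bregman psi dpsi z z' <= Mpsi.
  move=> Xz Xz'; rewrite -lee_fin -Mpsi_sup; apply: ereal_sup_ubound.
  by exists z => //; exists z'.
have B0 z z' : X z -> X z' -> 0 <= bregman psi dpsi z z'.
  move=> Xz Xz'; apply: le_trans (bregman_ge N X psi dpsi alpha X_convex
    psi_grad alpha_gt0 psi_sc z z' Xz Xz').
  by rewrite mulr_ge0 ?sqr_ge0 // divr_ge0 // ltW.
have [CX XC] := bregman_bounded_set N X psi dpsi alpha Mpsi xs hN X_convex
  psi_grad alpha_gt0 psi_sc xs_in (fun z Xz => BM z xs Xz xs_in).
have m_cont i := inverse_mirror_continuous N hN X psi dpsi alpha X_convex
  psi_grad alpha_gt0 psi_sc m i mirror_left.
have [eta_meas _ _] := xi_iid.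
have mx k : measurable_fun setT (x k : T -> borel_rV R n).
  have [+ _] := iterates_measurable_past X dpsi m eta G U x0 x y _ _ _ X_closed
    m_cont mirror_range mirror_right G_meas U_meas x_init y_init x_step y_step
    x_in k.
  by move=> h; exact: (measurableT_comp h (measurable_to_past eta eta_meas k)).
have mf k : measurable_fun setT (fun w => f (x k w)).
  exact: (measurable_comp_continuous_within R n _ T X f (x k)
    (gradient_on_continuous X f df f_grad) (x_in k) (mx k)).
pose D2 k w := dual_norm N (G (x k.+1 w) (xi k.+1 w)) ^+ 2.
(* first-order noise term of an iteration *)
pose L k w :=
  pairing (G (x k.+1 w) (xi k.+1 w) - df (x k.+1 w)) (xs - m (y k w)).
have D2P k : P.-integrable setT (EFin \o D2 k) /\
    (\int[P]_w (D2 k w)%:E <= (sigma ^+ 2)%:E)%E.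
  have [W [cW Ws]] := G_moment k; split; first by case: cW.
  by apply: cond_expectation_bounded_le cW Ws; exists setT => //; rewrite setTI.
have LP k : P.-integrable setT (EFin \o L k) /\ (\int[P]_w (L k w)%:E = 0)%E.
  pose F i w := (G (x k.+1 w) (xi k.+1 w) 0 i - df (x k.+1 w) 0 i) *
    (xs 0 i - m (y k w) 0 i).
  have LE w : (L k w)%:E = (\sum_(i < n) (F i w)%:E)%E.
    rewrite sumEFin /L /pairing; congr EFin; apply: eq_bigr => i _.
    by rewrite /F !mxE.
  have noise i : P.-integrable setT (fun w => (F i w)%:E) /\
      (\int[P]_w (F i w)%:E = 0)%E.
    have noise_mean0 := oracle_noise_mean0 P X dpsi m eta G U x0 x y _ _ _
      X_closed m_cont mirror_range mirror_right G_meas U_meas x_init y_init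
      x_step y_step x_in xi_iid (fun v => df v 0 i) i (fun z => xs 0 i - z 0 i)
      (`|xs| + CX) x0_in (lipschitz_gradient_continuous N X Lf df i hN f_lip).
    apply: (noise_mean0 _ _ k (G_unbiased k i)) => [|z Xz].
      apply: locally_lipschitz_continuous_within => v _; exists 1.
      rewrite near_withinE; apply: nearW => z _; rewrite mul1r.
      have -> : xs 0 i - z 0 i - (xs 0 i - v 0 i) = - (z 0 i - v 0 i) by ring.
      by rewrite normrN; have := coord_le_norm (z - v) i; rewrite !mxE.
    apply: le_trans (ler_normB _ _) _; apply: lerD; first exact: coord_le_norm.
    exact: le_trans (coord_le_norm _ _) (XC z Xz).
  split.
    have -> : EFin \o L k = fun w => (\sum_(i < n) (F i w)%:E)%E.
      by apply/funext => w; exact: LE.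
    by apply: integrable_sum => // i _; have [] := noise i.
  under eq_integral do rewrite LE.
  rewrite integral_sum // => [|i]; last by have [] := noise i.
  by rewrite big1 // => i _; have [] := noise i.
pose c k := a k ^+ 2 / s k / (2 * alpha).
have c_ge0 k : 0 <= c k.
  by rewrite !divr_ge0 ?sqr_ge0 ?mulr_ge0 ?(ltW alpha_gt0) // ltW.
pose q k w := c k * D2 k w + a k * L k w.
have qP k : P.-integrable setT (EFin \o q k) /\
    (\int[P]_w (q k w)%:E <= (c k * sigma ^+ 2)%:E)%E.
  have [iD ID] := D2P k; have [iL IL] := LP k.
  have iD' := integrableZl measurableT (c k) iD.
  have iL' := integrableZl measurableT (a k) iL.
  have qE w : ((q k w)%:E =
      (c k)%:E * (EFin \o D2 k) w + (a k)%:E * (EFin \o L k) w)%E.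
    by rewrite /q EFinD !EFinM.
  split.
    have -> : EFin \o q k = (fun w => (c k)%:E * (EFin \o D2 k) w +
        (a k)%:E * (EFin \o L k) w)%E by apply/funext => w; exact: qE.
    exact: integrableD.
  under eq_integral do rewrite qE.
  rewrite integralD // !integralZl // IL mule0 adde0 [in leRHS]EFinM.
  by apply: lee_wpmul2l; [rewrite lee_fin|exact: ID].
pose e0 := A 0%N * (f x0 - f xs) + s 0%N * bregman psi dpsi xs x0.
have e0_ge0 : 0 <= e0.
  apply: addr_ge0; apply: mulr_ge0; [exact: ltW| |exact: ltW|exact: B0].
  by rewrite subr_ge0 xs_min.
have E0E : E0 = e0.
  rewrite /E0 /asmd_energy (_ : (fun w => _) = cst e0) ?expectation_cst //.
  by apply/funext => w; rewrite x_init y_init mirror_left.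
(* almost sure bound on the objective gap *)
have gap : {ae P, forall w, forall k, A k * (f (x k w) - f xs) <=
    e0 + (s k - s 0%N) * Mpsi + (A k - A 0%N) * K + \sum_(j < k) q j w}.
  apply: filterS (ae_foralln hK) => w hKw k.
  pose E j := A j * (f (x j w) - f xs) + s j * bregman psi dpsi xs (m (y j w)).
  have step j : E j.+1 <=
      E j + (s j.+1 - s j) * Mpsi + (A j.+1 - A j) * K + q j w.
    apply: (asmd_step N X psi f dpsi df alpha Mpsi K (A j) (A j.+1)
      (s j) (s j.+1) xs (x j w) (x j.+1 w) (m (y j w)) (m (y j.+1 w)) (U (y j w))) => //.
    - move=> v Xv.
      exact: convex_function_gradient_le X_convex f_convex f_grad _ Xv.
    - by have := a_ge0 j; rewrite subr_ge0.
    - exact: asmd_s_le.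
    - rewrite x_step; have [-> ->] := asmd_x_weights (R := R) j.
      rewrite scalerDr !scalerA ![A j.+1 * _]mulrC !divfK // gt_eqF //.
    - by rewrite !mirror_right y_step.
    - exact: BM.
  have := telescoped_energy_le E s A (fun j => q j w) Mpsi K step k.
  rewrite {2}/E x_init y_init [m _]mirror_left // -/e0; apply: le_trans.
  by rewrite /E lerDl mulr_ge0 ?(ltW (s_gt0 _)) // B0.
(* the same bound in expectation *)
pose B := Mpsi + sigma ^+ 2 / (2 * alpha).
have B_ge0 : 0 <= B.
  by rewrite addr_ge0 ?(ltW Mpsi_gt0) // divr_ge0 ?sqr_ge0 ?mulr_ge0 // ltW.
have Egap k : ('E_P[fun w => (f (x k w) - f xs)%R] <=
    ((e0 + s k * B + (A k - 1 / 2) * K) / A k)%:E)%E.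
  pose b := e0 + (s k - s 0%N) * Mpsi + (A k - A 0%N) * K.
  pose h w := (A k)^-1 * (b + \sum_(j < k) q j w).
  have isum : P.-integrable setT (fun w => (\sum_(j < k) (q j w)%:E)%E).
    by apply: integrable_sum => // j _; have [] := qP j.
  have ib : P.-integrable setT (EFin \o cst b).
    exact: finite_measure_integrable_cst.
  have hE w : ((h w)%:E = ((A k)^-1)%:E *
      ((EFin \o cst b) w + \sum_(j < k) (q j w)%:E))%E.
    by rewrite /h EFinM EFinD sumEFin.
  have ih : P.-integrable setT (EFin \o h).
    have -> : EFin \o h = (fun w => ((A k)^-1)%:E *
        ((EFin \o cst b) w + \sum_(j < k) (q j w)%:E))%E.
      by apply/funext => w; exact: hE.
    by apply: integrableZl => //; exact: integrableD.
  apply: le_trans (ge0_ae_le_expectation P _ h _ _ ih _) _.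
  - exact: measurable_funB.
  - by move=> w; rewrite subr_ge0 xs_min.
  - by apply: filterS gap => w /(_ k); rewrite /h ler_pdivlMl.
  under eq_integral do rewrite hE.
  rewrite integralZl //; last exact: integrableD.
  rewrite integralD //; have := expectation_cst P b; rewrite unlock => ->.
  rewrite integral_sum // => [|j]; last by have [] := qP j.
  have H : (\sum_(j < k) \int[P]_w (q j w)%:E <=
      (s k * (sigma ^+ 2 / (2 * alpha)))%:E)%E.
    apply: (@le_trans _ _ (\sum_(j < k) (c j * sigma ^+ 2)%:E)%E).
      by apply: lee_sum => j _; have [] := qP j.
    rewrite sumEFin lee_fin.
    have -> : \sum_(j < k) c j * sigma ^+ 2 =
        (\sum_(j < k) a j ^+ 2 / s j) * (sigma ^+ 2 / (2 * alpha)).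
      rewrite mulr_suml; apply: eq_bigr => j _; rewrite /c; field.
      by rewrite !gt_eqF.
    apply: ler_wpM2r; last exact: sum_asmd_step_le.
    by rewrite divr_ge0 ?sqr_ge0 ?mulr_ge0 // ltW.
  apply: (@le_trans _ _ (((A k)^-1)%:E *
      (b%:E + (s k * (sigma ^+ 2 / (2 * alpha)))%:E))%E).
    apply: lee_wpmul2l; last exact: leeD2l.
    by rewrite lee_fin invr_ge0 ltW.
  rewrite -EFinD -EFinM lee_fin mulrC ler_wpM2r ?invr_ge0 ?(ltW (A_gt0 _)) //.
  rewrite /b /B {2}/A /asmd_A.
  have : 0 <= s 0%N * Mpsi by rewrite mulr_ge0 ?(ltW (s_gt0 _)) // ltW.
  lra.
(* otherwise the bound on the nonnegative gap would become negative *)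
have K_ge0 : 0 <= K.
  apply: (asmd_bound_constant_ge0 e0 B K) => // k.
  rewrite -(pmulr_lge0 _ (_ : 0 < (A k)^-1)) ?invr_gt0 // -lee_fin.
  apply: le_trans (Egap k); apply: expectation_ge0 => w.
  by rewrite subr_ge0 xs_min.
pose V := (8 * Lf ^+ 2 * Mpsi + 2 * alpha * sigma ^+ 2 +
  4 * dual_norm N (df xs) ^+ 2) / alpha ^+ 2.
(* sigma ^ 2 / (2 * alpha) is at most its share 2 * sigma ^ 2 / alpha of V *)
have V_ge : sigma ^+ 2 / (2 * alpha) <= V.
  rewrite /V ler_pdivlMr ?exprn_gt0 //.
  have -> : sigma ^+ 2 / (2 * alpha) * alpha ^+ 2 = alpha * sigma ^+ 2 / 2.
    by field; rewrite gt_eqF.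
  have : 0 <= Lf ^+ 2 * Mpsi by rewrite mulr_ge0 ?sqr_ge0 // ltW.
  have : 0 <= alpha * sigma ^+ 2 by rewrite mulr_ge0 ?sqr_ge0 // ltW.
  have : 0 <= dual_norm N (df xs) ^+ 2 by exact: sqr_ge0.
  lra.
split=> [k|].
  apply: le_trans (Egap k) _; rewrite lee_fin ler_pdivrMr //.
  rewrite /rate E0E -/(asmd_s R k) -/V -/(A k) -/(s k).
  have -> : (K + (e0 / A k + s k / A k * (Mpsi + V))) * A k =
      K * A k + e0 + s k * (Mpsi + V) by field; rewrite gt_eqF.
  have : s k * (sigma ^+ 2 / (2 * alpha)) <= s k * V.
    by rewrite ler_wpM2l // ltW.
  rewrite /B; lra.
rewrite /rate E0E; apply: asmd_rate_bigO => //.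
rewrite addr_ge0 ?(ltW Mpsi_gt0) //; apply: le_trans V_ge.
by rewrite divr_ge0 ?sqr_ge0 ?mulr_ge0 // ltW.
Qed.
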